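(* Let $\mathcal V$ be a SIC set of rank-one projectors on $\mathbb{C}^d$, let $G$ be its orthogonality graph with vertex set $\{1,\dots,|G|\}$, let $N_x$ denote the set of vertices adjacent to $x$, and put $N=\sum_x|N_x|+|G|$. Consider the vertex equality problem in bounded dimension $d$, with figure of merit $$S^{(1)}=\frac1N\left(\sum_{x}p(0|x,x)+\sum_{x}\sum_{y\in N_x}p(1|x,y)\right).$$ Then: (1) the maximum value $S^{(1)}=1$ is achieved by a $d$-dimensional quantum communication strategy; (2) the optimal value of $S^{(1)}$ over $d$-dimensional classical communication strategies is $$S^{(1)}_c=1-\frac{\kappa}{N},$$ where $\kappa$ is the minimum, over all assignments of at most $d$ colors to the vertices of $G$ (i.e. all maps $\{1,\dots,|G|\}\to\{1,\dots,d\}$), of the number of vertices that are not properly colored, a vertex being not properly colored if at least one of its neighbors is assigned the same color; (3) $S^{(1)}_c$ is strictly less than one.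
   Context: SIC set (state-independent contextuality set): a finite set of distinct rank-one projectors $\{\Pi_1,\dots,\Pi_n\}$ on $\mathbb{C}^d$ for which there is a noncontextuality inequality violated by every quantum state; that is, there exist weights $w_i\ge 0$ and a number $0\le \beta<1$ such that $\sum_{i\in I}w_i\le \beta$ for every independent set $I$ of the orthogonality graph (noncontextual $0/1$ assignments are those in which no two orthogonal projectors both get value $1$), while $\sum_i w_i\Pi_i\ge \mathbb{1}$, i.e. $\sum_i w_i\,\mathrm{Tr}(\rho\,\Pi_i)\ge 1$ for every state $\rho$ on $\mathbb{C}^d$. Orthogonality graph: vertices correspond to the projectors, two vertices being adjacent iff the corresponding projectors are orthogonal. Vertex equality problem: Alice receives $x$ and Bob receives $y$, both from the vertex set of $G$; Alice sends one system to Bob, and Bob outputs $z\in\{0,1\}$. Only input pairs with $y=x$ (correct answer $z=0$) or $y\in N_x$ (correct answer $z=1$) count. $d$-dimensional classical communication strategy: conditional probabilities $p_e(\tau|x)$, $\tau\in\{1,\dots,d\}$, with $\sum_\tau p_e(\tau|x)=1$, and $p_d(z|y,\tau)$, with $p_d(0|y,\tau)+p_d(1|y,\tau)=1$; the observed probabilities are $p(z|x,y)=\sum_{\tau=1}^d p_e(\tau|x)\,p_d(z|y,\tau)$. $d$-dimensional quantum communication strategy: density operators $\rho_x$ on $\mathbb{C}^d$ and two-outcome measurements $\{M^0_y,M^1_y\}$ (positive semidefinite operators with $M^0_y+M^1_y=\mathbb{1}$); the observed probabilities are $p(z|x,y)=\mathrm{Tr}(\rho_xM^z_y)$. *)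

(* Defs.v *)
From HB Require Import structures.
From mathcomp Require Import all_boot all_order all_algebra.
From mathcomp Require Import complex.
From mathcomp Require Import all_classical reals.

Set Implicit Arguments.
Unset Strict Implicit.
Unset Printing Implicit Defensive.

Import Order.TTheory GRing.Theory Num.Theory.
Local Open Scope sesquilinear_scope.
Local Open Scope classical_set_scope.
Local Open Scope ring_scope.

Section Operators.
Variables (C : numClosedFieldType) (d : nat).
Implicit Types A : 'M[C]_d.

(* The inequality lives in the partial order of C, so it also says that the
   quadratic form takes real values. *)
Definition psd A : Prop :=
  A \is hermsymmx /\ forall v : 'cV[C]_d, 0 <= (v ^t* *m A *m v) ord0 ord0.

Definition loewner_le A B : Prop := psd (B - A).

Definition density A : Prop := psd A /\ \tr A = 1.

Definition rank_one_projector A : Prop :=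
  [/\ A \is hermsymmx, A *m A = A & \rank A = 1%N].

(* This is irreflexive on rank-one projectors, as A *m A = A is then nonzero. *)
Definition orthogonality (T : finType) (Pi : T -> 'M[C]_d) : rel T :=
  fun x y => Pi x *m Pi y == 0.

End Operators.

Definition independent (T : finType) (e : rel T) (I : {set T}) : Prop :=
  {in I &, forall x y, ~~ e x y}.

Definition SIC_set (R : realType) (d : nat) (T : finType)
    (Pi : T -> 'M[R[i]]_d) : Prop :=
  [/\ injective Pi,
      forall x, rank_one_projector (Pi x)
    & exists (w : T -> R) (beta : R),
        [/\ forall x, 0 <= w x,
            0 <= beta < 1,
            forall I : {set T}, independent (orthogonality Pi) I ->
              \sum_(x in I) w x <= beta
          & loewner_le 1%:M (\sum_x (w x)%:C%C *: Pi x)]].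

Section VertexEquality.
Variables (T : finType) (e : rel T).

Definition neighbors (x : T) : {set T} := [set y | e x y]%SET.

Definition num_inputs : nat := (\sum_x #|neighbors x| + #|T|)%N.

(* p z x y is the probability p(z|x,y); the answers 0 and 1 are false and
   true. *)
Definition merit (F : numFieldType) (p : bool -> T -> T -> F) : F :=
  num_inputs%:R^-1 *
    (\sum_x p false x x + \sum_x \sum_(y in neighbors x) p true x y).

Definition classical_behavior (R : realType) (d : nat) :
    set (bool -> T -> T -> R) :=
  [set p | exists (pe : T -> 'I_d -> R) (pd : T -> 'I_d -> bool -> R),
     [/\ forall x tau, 0 <= pe x tau,
         forall x, \sum_tau pe x tau = 1,
         forall y tau z, 0 <= pd y tau z,
         forall y tau, pd y tau false + pd y tau true = 1
       & forall z x y, p z x y = \sum_tau pe x tau * pd y tau z]].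

Definition quantum_behavior (R : realType) (d : nat) :
    set (bool -> T -> T -> R[i]) :=
  [set p | exists (rho : T -> 'M[R[i]]_d) (M : T -> bool -> 'M[R[i]]_d),
     [/\ forall x, density (rho x),
         forall y z, psd (M y z),
         forall y, M y false + M y true = 1%:M
       & forall z x y, p z x y = \tr (rho x *m M y z)]].

Definition badly_colored (d : nat) (c : {ffun T -> 'I_d}) : {set T} :=
  [set x | [exists y in neighbors x, c y == c x]]%SET.

(* As each cardinal is at most #|T|, the seed #|T| does not affect the minimum
   when 0 < d. *)
Definition kappa (d : nat) : nat :=
  \big[minn/#|T|]_(c : {ffun T -> 'I_d}) #|badly_colored c|.

End VertexEquality.

Arguments classical_behavior {T} R d _.
Arguments quantum_behavior {T} R d _.

Definition is_maximum disp (X : porderType disp) (A : set X) (m : X) : Prop :=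
  A m /\ ubound A m.

(* Main.v *)
(** On inputs from the scored pairs, a strategy loses exactly the total
    probability of its wrong answers. Sending [Pi x] and measuring [Pi y] never
    errs. For a classical strategy, drawing the color of each vertex [x]
    independently from [p_e(.|x)] turns the loss into an average, over all
    colorings, of the loss of the corresponding deterministic encoding, and
    every badly colored vertex costs at least 1 there, whatever the decoding.
    Finally, a proper [d]-coloring would split the vertices into [d]
    independent sets, each of weight at most [beta < 1], contradicting
    [\sum_x w x >= d], which is the trace of the SIC inequality. *)
Require Import Defs.
From mathcomp Require Import all_boot all_order all_algebra.
From mathcomp Require Import complex.
From mathcomp Require Import all_classical reals.

Import Order.TTheory GRing.Theory Num.Theory.
Local Open Scope sesquilinear_scope.
Local Open Scope classical_set_scope.
Local Open Scope ring_scope.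

(** * Positive semidefinite matrices and rank-one projectors *)

Lemma hermsymmxP {C : numClosedFieldType} {d : nat} {A : 'M[C]_d} :
  reflect (A ^t* = A) (A \is hermsymmx).
Proof.
rewrite is_hermitianmxE expr0 scale1r eq_sym.
exact: eqP.
Qed.

Lemma trmxC_mul {C : numClosedFieldType} {m n p : nat}
    (A : 'M[C]_(m, n)) (B : 'M[C]_(n, p)) : (A *m B) ^t* = B ^t* *m A ^t*.
Proof. by rewrite trmx_mul map_mxM. Qed.

(** Here [A] equals [A ^t* *m A], so the quadratic form at [v] is the squared norm of [A *m v]. *)
Lemma psd_hermitian_idempotent {C : numClosedFieldType} {d : nat}
    (A : 'M[C]_d) : A \is hermsymmx -> A *m A = A -> psd A.
Proof.
move=> Aherm Aidem; split=> // v.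
have -> : v ^t* *m A *m v = (A *m v) ^t* *m (A *m v).
  by rewrite trmxC_mul (hermsymmxP Aherm) !mulmxA -(mulmxA _ A A) Aidem.
rewrite mxE; apply: sumr_ge0 => i _; rewrite !mxE -normCKC.
exact: exprn_ge0.
Qed.

Lemma psd_projector {C : numClosedFieldType} {d : nat} (A : 'M[C]_d) :
  rank_one_projector A -> psd A.
Proof. by case=> ? ? _; apply: psd_hermitian_idempotent. Qed.

Lemma psd_projector_compl {C : numClosedFieldType} {d : nat} (A : 'M[C]_d) :
  rank_one_projector A -> psd (1%:M - A).
Proof.
case=> /hermsymmxP Aherm Aidem _; apply: psd_hermitian_idempotent.
  apply/hermsymmxP; by rewrite linearB /= map_mxB Aherm trmx1 map_mx1.
by rewrite mulmxBl mul1mx mulmxBr mulmx1 Aidem subrr subr0.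
Qed.

(** The entry is the quadratic form of [A] at the [i]-th column of [P ^t*]. *)
Lemma psd_congruence_diag_ge0 {C : numClosedFieldType} {d : nat}
    (A P : 'M[C]_d) (i : 'I_d) : psd A -> 0 <= (P *m A *m P ^t*) i i.
Proof.
case=> _ /(_ (col i (P ^t*))).
have -> : (col i (P ^t*)) ^t* = row i P.
  by apply/matrixP=> j k; rewrite !mxE conjCK.
by rewrite -row_mul colE mulmxA -colE -row_mul !mxE.
Qed.

Lemma mxtrace_psd_ge0 {C : numClosedFieldType} {d : nat} (A : 'M[C]_d) :
  psd A -> 0 <= \tr A.
Proof.
move=> Apsd; apply: sumr_ge0 => i _.
have := psd_congruence_diag_ge0 A 1%:M i Apsd.
by rewrite trmx1 map_mx1 mul1mx mulmx1.
Qed.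

(* In an orthonormal eigenbasis of B the trace is the sum of the products of
   the diagonal entries of A and B, all of which are nonnegative. *)
Lemma mxtrace_mul_psd_ge0 {C : numClosedFieldType} {d : nat}
    (A B : 'M[C]_d) : psd A -> psd B -> 0 <= \tr (A *m B).
Proof.
move=> Apsd Bpsd.
have /hermitian_normalmx/orthomx_spectralP := Bpsd.1.
set P := spectralmx B; set D := spectral_diag B => B_eq.
have Punit : P \is unitarymx by apply: spectral_unitarymx.
rewrite invmx_unitary // in B_eq.
have PP : P *m P ^t* = 1%:M by apply/unitarymxP.
have D_ge0 i : 0 <= D 0 i.
  have := psd_congruence_diag_ge0 B P i Bpsd.
  by rewrite B_eq !mulmxA PP mul1mx -mulmxA PP mulmx1 mxE eqxx mulr1n.
rewrite B_eq !mulmxA mxtrace_mulC !mulmxA mul_mx_diag.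
apply: sumr_ge0 => i _; rewrite mxE mulr_ge0 //.
exact: psd_congruence_diag_ge0.
Qed.

(** In the factorization [A = col_base A *m row_base A], idempotence forces the reversed product to
    be the identity of size [\rank A], and both products have the same trace. *)
Lemma mxtrace_rank_one_projector {C : numClosedFieldType} {d : nat}
    (A : 'M[C]_d) : rank_one_projector A -> \tr A = 1.
Proof.
case=> _ Aidem Arank.
have RC : row_base A *m col_base A = 1%:M.
  apply: (row_full_inj (col_base_full A)).
  apply: (row_free_inj (row_base_free A)).
  by rewrite /= mulmx1 mulmxA mulmx_base -mulmxA mulmx_base Aidem.
by rewrite -[A]mulmx_base mxtrace_mulC RC mxtrace1 Arank.
Qed.

(** * Merit as one minus the normalized loss *)

(** Grouped by Bob's input [y], because the classical bound charges each badly colored [y]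
    separately. *)
Definition merit_loss {T : finType} (e : rel T) {F : numFieldType}
    (p : bool -> T -> T -> F) : F :=
  \sum_y (p true y y + \sum_(x | e x y) p false x y).

Lemma meritE {T : finType} (e : rel T) {F : numFieldType}
    (p : bool -> T -> T -> F) :
  (forall x y, p false x y + p true x y = 1) -> (0 < #|T|)%N ->
  merit e p = 1 - merit_loss e p / (num_inputs e)%:R.
Proof.
move=> p1 T_gt0.
have N_neq0 : (num_inputs e)%:R != 0 :> F.
  by rewrite pnatr_eq0 -lt0n /num_inputs addn_gt0 T_gt0 orbT.
apply: (mulfI N_neq0); rewrite /merit mulVKf // mulrBr mulr1 mulrCA divff //.
rewrite mulr1; apply/eqP; rewrite eq_sym subr_eq; apply/eqP.
have diagE : \sum_x p false x x + \sum_x p true x x = #|T|%:R.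
  by rewrite -big_split /= (eq_bigr (fun=> 1)) ?sumr_const.
(* The merit groups edges by [x] and the loss by [y]; after exchanging sums, right and wrong answers
   pair up to 1 on each edge. *)
have edgeE : \sum_x \sum_(y in neighbors e x) p true x y +
    \sum_y \sum_(x | e x y) p false x y = (\sum_x #|neighbors e x|)%:R.
  rewrite [X in _ + X](exchange_big_dep xpredT) //= -big_split natr_sum /=.
  apply: eq_bigr => x _; rewrite [X in _ + X](eq_bigl (mem (neighbors e x))).
    rewrite -big_split /= -sumr_const; apply: eq_bigr => y _.
    by rewrite addrC p1.
  by move=> y; rewrite /= inE.
by rewrite /merit_loss big_split addrACA diagE edgeE /num_inputs natrD addrC.
Qed.

(** * Colorings and classical strategies *)

Lemma kappa_le {T : finType} (e : rel T) {d : nat} (c : {ffun T -> 'I_d}) :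
  (kappa e d <= #|badly_colored e c|)%N.
Proof. exact: (bigmin_le #|T| c (fun c => #|badly_colored e c|)). Qed.

Lemma kappa_attained {T : finType} (e : rel T) {d : nat} : (0 < d)%N ->
  exists c : {ffun T -> 'I_d}, kappa e d = #|badly_colored e c|.
Proof.
case: d => // d _.
have bad_le (c : {ffun T -> 'I_d.+1}) : xpredT c ->
    (#|badly_colored e c| <= #|T|)%O.
  by move=> _; apply: max_card.
have [c _ kappaE] := eq_bigmin [ffun=> ord0] xpredT _ isT bad_le.
by exists c.
Qed.

Lemma badly_coloredP {T : finType} {e : rel T} {d : nat}
    {c : {ffun T -> 'I_d}} {x : T} :
  reflect (exists2 y, e x y & c y = c x) (x \in badly_colored e c).
Proof.
rewrite inE; apply: (iffP exists_inP) => [[y]|[y exy cE]].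
  by rewrite inE => exy /eqP; exists y.
by exists y; rewrite ?inE ?cE.
Qed.

(** The product measure: for a probability kernel [q], the probability of [c] when the colors are
    drawn independently. *)
Definition coloring_weight {F : numFieldType} {T : finType} {d : nat}
    (q : T -> 'I_d -> F) (c : {ffun T -> 'I_d}) : F := \prod_x q x (c x).

Section ColoringWeight.
Variables (F : numFieldType) (T : finType) (d : nat) (q : T -> 'I_d -> F).
Hypothesis q_sum1 : forall x, \sum_tau q x tau = 1.

Lemma sum_coloring_weight : \sum_(c : {ffun T -> 'I_d}) coloring_weight q c = 1.
Proof. by rewrite -(bigA_distr_bigA q) big1. Qed.

Lemma coloring_weight_marginal (x : T) (g : 'I_d -> F) :
  \sum_(c : {ffun T -> 'I_d}) coloring_weight q c * g (c x) =
    \sum_tau q x tau * g tau.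
Proof.
(* Absorbing [g] into the factor at [x] keeps the summand a product over vertices, so the sum over
   colorings factors; every other factor sums to 1. *)
pose f y tau := q y tau * (if y == x then g tau else 1).
transitivity (\sum_(c : {ffun T -> 'I_d}) \prod_y f y (c y)).
  apply: eq_bigr => c _; rewrite /f big_split /=; congr (_ * _).
  by rewrite -big_mkcond big_pred1_eq.
rewrite -(bigA_distr_bigA f) (bigD1 x) //= /f eqxx.
rewrite [X in _ * X]big1 ?mulr1 // => y /negbTE ->.
by rewrite -[RHS](q_sum1 y); apply: eq_bigr => tau _; rewrite mulr1.
Qed.

End ColoringWeight.

(* Under the encoding c, a badly colored y with a neighbor x of the same color
   contributes at least pd(1|y, c y) + pd(0|y, c y) = 1. *)
Lemma kappa_le_loss {R : realType} {T : finType} (e : rel T) {d : nat}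
    (e_sym : symmetric e) (p : bool -> T -> T -> R) :
  classical_behavior R d p -> (kappa e d)%:R <= merit_loss e p.
Proof.
case=> pe [pd [pe_ge0 pe_sum pd_ge0 pd_sum pE]].
pose W := coloring_weight pe.
(* The loss when Alice encodes by [c] and Bob keeps decoding by [pd]. *)
pose L (c : {ffun T -> 'I_d}) :=
  \sum_y (pd y (c y) true + \sum_(x | e x y) pd y (c x) false).
have -> : merit_loss e p = \sum_c W c * L c.
  have pEW z x y : p z x y = \sum_c W c * pd y (c x) z.
    by rewrite pE (coloring_weight_marginal _ _ _ _ _ _ (pd y ^~ z)).
  under [RHS]eq_bigr do rewrite mulr_sumr.
  rewrite exchange_big /=; apply: eq_bigr => y _.
  rewrite pEW (eq_bigr _ (fun x _ => pEW false x y)) exchange_big /=.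
  rewrite -big_split /=; apply: eq_bigr => c _.
  by rewrite mulrDr mulr_sumr.
have L_ge c : (kappa e d)%:R <= L c.
  apply: (@le_trans _ _ (#|badly_colored e c|%:R)).
    by rewrite ler_nat kappa_le.
  rewrite -sum1_card natr_sum big_mkcond /=; apply: ler_sum => y _.
  case: badly_coloredP => [[x eyx cE]|_].
    rewrite -(pd_sum y (c y)) addrC lerD2l (bigD1 x) 1?e_sym //= cE lerDl.
    exact: sumr_ge0.
  by rewrite addr_ge0 // sumr_ge0.
have -> : (kappa e d)%:R = \sum_c W c * (kappa e d)%:R.
  by rewrite -mulr_suml sum_coloring_weight // mul1r.
apply: ler_sum => c _; apply: ler_wpM2l; last exact: L_ge.
by apply: prodr_ge0 => x _; apply: pe_ge0.
Qed.

(* Alice sends the color of x; Bob answers 0 only when he receives the color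
   of y and y is properly colored, so that the only errors are those at (y, y)
   for y badly colored. *)
Lemma coloring_behavior (R : realType) {T : finType} (e : rel T) {d : nat}
    (e_sym : symmetric e) (c : {ffun T -> 'I_d}) :
  exists2 p, classical_behavior R d p &
    merit_loss e p = #|badly_colored e c|%:R.
Proof.
pose ans0 y tau := (tau == c y) && (y \notin badly_colored e c).
pose p z x y : R := (ans0 y (c x) (+) z)%:R.
exists p.
  exists (fun x tau => (tau == c x)%:R), (fun y tau z => (ans0 y tau (+) z)%:R).
  split=> [x tau|x|y tau z|y tau|z x y]; rewrite ?ler0n //.
  - by rewrite (bigD1 (c x)) //= eqxx big1 ?addr0 // => tau /negbTE ->.
  - by case: (ans0 y tau); rewrite ?addr0 ?add0r.
  - by rewrite (bigD1 (c x)) //= eqxx mul1r big1 ?addr0 // => tau /negbTE->;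
      rewrite mul0r.
rewrite /merit_loss -sum1_card natr_sum [RHS]big_mkcond /=.
apply: eq_bigr => y _.
rewrite big1 => [|x exy]; rewrite /p /ans0.
  by rewrite eqxx /= addr0; case: (y \in _).
(* A wrong 0 on an edge would need [c x = c y], but then [y] is badly colored and Bob answers 1. *)
have [cE|//] := eqVneq (c x) (c y).
suff -> : y \in badly_colored e c by [].
by apply/badly_coloredP; exists x; rewrite // e_sym.
Qed.

(** * Orthogonality graphs of SIC sets *)

Lemma orthogonality_sym {C : numClosedFieldType} {d : nat} {T : finType}
    (Pi : T -> 'M[C]_d) :
  (forall x, rank_one_projector (Pi x)) -> symmetric (orthogonality Pi).
Proof.
move=> PiP.
have sub x y : orthogonality Pi x y -> orthogonality Pi y x.
  move=> /eqP /(congr1 (fun A => A ^t*)); rewrite trmxC_mul trmx0 map_mx0.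
  have [/hermsymmxP -> _ _] := PiP x; have [/hermsymmxP -> _ _] := PiP y.
  by move/eqP.
by move=> x y; apply/idP/idP; apply: sub.
Qed.

Lemma SIC_kappa_gt0 {R : realType} {d : nat} {T : finType}
    (Pi : T -> 'M[R[i]]_d) :
  (0 < d)%N -> SIC_set Pi -> (0 < kappa (orthogonality Pi) d)%N.
Proof.
move=> d_gt0 [_ PiP [w [beta [w_ge0 /andP[_ beta_lt1] w_ind w_ge1]]]].
have [c ->] := kappa_attained (orthogonality Pi) d_gt0.
rewrite lt0n; apply/eqP => /cards0_eq bad0.
(* With no badly colored vertex, each color class is independent. *)
have class_le tau : \sum_(x | c x == tau) w x <= beta.
  rewrite (eq_bigl (mem [set x | c x == tau]%SET)); last first.
    by move=> x; rewrite /= inE.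
  apply: w_ind => x y; rewrite !inE => /eqP cx /eqP cy; apply/negP => exy.
  suff : x \in badly_colored (orthogonality Pi) c by rewrite bad0 inE.
  by apply/badly_coloredP; exists y; rewrite // cx cy.
have total_le : \sum_x w x <= d%:R * beta.
  rewrite (partition_big c xpredT) //= mulr_natl -[d in _ *+ d]card_ord.
  by rewrite -sumr_const; apply: ler_sum.
have : d%:R <= \sum_x w x.
  have := mxtrace_psd_ge0 _ w_ge1.
  rewrite raddfB /= mxtrace1 raddf_sum /=.
  under eq_bigr do rewrite mxtraceZ mxtrace_rank_one_projector // mulr1.
  by rewrite -rmorph_sum /= -(rmorph_nat (real_complex R)) subr_ge0 lecR.
move=> /le_trans /(_ total_le).
by rewrite ler_pMr ?ltr0n // leNgt beta_lt1.
Qed.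

(** Follows from [0 < kappa <= #|T|]; it ensures that the normalization is nonzero. *)
Lemma SIC_card_gt0 {R : realType} {d : nat} {T : finType}
    (Pi : T -> 'M[R[i]]_d) : (0 < d)%N -> SIC_set Pi -> (0 < #|T|)%N.
Proof.
move=> d_gt0 /(SIC_kappa_gt0 _ d_gt0) /leq_trans; apply.
have [c ->] := kappa_attained (orthogonality Pi) d_gt0.
exact: max_card.
Qed.

(** * Normalization of strategies and the optimal values *)

Lemma quantum_behavior_complete {R : realType} {d : nat} {T : finType}
    (p : bool -> T -> T -> R[i]) :
  quantum_behavior R d p -> forall x y, p false x y + p true x y = 1.
Proof.
case=> rho [M [rhoP _ M1 pE]] x y.
by rewrite !pE -mxtraceD -mulmxDr M1 mulmx1 (rhoP x).2.
Qed.

Lemma quantum_behavior_ge0 {R : realType} {d : nat} {T : finType}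
    (p : bool -> T -> T -> R[i]) :
  quantum_behavior R d p -> forall z x y, 0 <= p z x y.
Proof.
case=> rho [M [rhoP MP _ pE]] z x y.
by rewrite pE; apply: mxtrace_mul_psd_ge0 => //; case: (rhoP x).
Qed.

Lemma classical_behavior_complete {R : realType} {d : nat} {T : finType}
    (p : bool -> T -> T -> R) :
  classical_behavior R d p -> forall x y, p false x y + p true x y = 1.
Proof.
case=> pe [pd [_ pe_sum _ pd_sum pE]] x y.
rewrite !pE -big_split -[RHS](pe_sum x) /=; apply: eq_bigr => tau _.
by rewrite -mulrDr pd_sum mulr1.
Qed.

Lemma projector_behavior {R : realType} {d : nat} {T : finType}
    (Pi : T -> 'M[R[i]]_d) :
  (forall x, rank_one_projector (Pi x)) ->
  exists2 p, quantum_behavior R d p & merit_loss (orthogonality Pi) p = 0.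
Proof.
move=> PiP.
pose M y (z : bool) := if z then 1%:M - Pi y else Pi y.
exists (fun z x y => \tr (Pi x *m M y z)).
  exists Pi, M; split=> // [x|y z|y].
  - by split; [exact: psd_projector | exact: mxtrace_rank_one_projector].
  - by rewrite /M; case: z; [exact: psd_projector_compl | exact: psd_projector].
  - by rewrite /M addrC subrK.
rewrite /merit_loss big1 // => y _; rewrite /M.
have [_ PP _] := PiP y.
rewrite mulmxBr mulmx1 PP subrr mxtrace0 add0r.
by rewrite big1 // => x /eqP ->; rewrite mxtrace0.
Qed.

Theorem proposition2 (R : realType) (d n : nat) (Pi : 'I_n -> 'M[R[i]]_d)
    (d_gt0 : (0 < d)%N) (Pi_SIC : SIC_set Pi) :
  let G := orthogonality Pi in
  let N := num_inputs G in
  is_maximum [set merit G p | p in quantum_behavior R d] 1 /\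
  exists Sc : R,
    [/\ is_maximum [set merit G p | p in classical_behavior R d] Sc,
        Sc = 1 - (kappa G d)%:R / N%:R
      & Sc < 1].
Proof.
move=> G N.
have [_ PiP _] := Pi_SIC.
have n_gt0 := SIC_card_gt0 _ d_gt0 Pi_SIC.
have G_sym : symmetric G := orthogonality_sym _ PiP.
have N_gt0 : (0 < N)%N by rewrite /N /num_inputs addn_gt0 n_gt0 orbT.
split.
  split=> [|_ [p pQ <-]].
    have [p pQ loss0] := projector_behavior _ PiP.
    exists p => //; rewrite meritE ?loss0 ?mul0r ?subr0 //.
    exact: quantum_behavior_complete pQ.
  rewrite meritE //; last exact: quantum_behavior_complete pQ.
  rewrite gerBl mulr_ge0 ?invr_ge0 ?ler0n //.
  by apply: sumr_ge0 => y _; rewrite addr_ge0 ?sumr_ge0 // => *;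
    apply: quantum_behavior_ge0 pQ _ _ _.
exists (1 - (kappa G d)%:R / N%:R); split=> //; last first.
  by rewrite gtrBl divr_gt0 ?ltr0n // SIC_kappa_gt0.
split=> [|_ [p pC <-]].
  have [c ->] := kappa_attained G d_gt0.
  have [p pC lossE] := coloring_behavior R G G_sym c.
  exists p => //; rewrite meritE ?lossE //.
  exact: classical_behavior_complete pC.
rewrite meritE //; last exact: classical_behavior_complete pC.
by rewrite lerD2l lerN2 ler_pM2r ?invr_gt0 ?ltr0n // (kappa_le_loss _ G_sym).
Qed.
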